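(* Let $\alpha>0$, $\beta>0$ and $|\xi|>1$; put $\varepsilon=1$ if $\xi<-1$ and $\varepsilon=-1$ if $\xi>1$. Let $A_n(\lambda)$ be the polynomials defined by $A_n(\lambda)=(\lambda+B_n)A_{n-1}(\lambda)-C_nA_{n-2}(\lambda)$ for $n\ge2$, where $$B_n=\frac{\varepsilon}{n(n+\alpha+\beta-1)}\Big(\xi-\frac{(\beta-\alpha)(\alpha+\beta-2)}{(2n+\alpha+\beta-2)(2n+\alpha+\beta)}\Big),$$ $$C_n=\frac{4(n+\alpha-1)(n+\beta-1)}{(n-1)(n+\alpha+\beta-1)(2n+\alpha+\beta-1)(2n+\alpha+\beta-2)^2(2n+\alpha+\beta-3)},$$ with $A_0(\lambda)=1$ and $$A_1(\lambda)=\lambda+\frac{\varepsilon}{\alpha+\beta}\Big(\xi-\frac{(\beta-\alpha)(\alpha+\beta-2)}{(2+\alpha+\beta)(\alpha+\beta)}-\frac{4\alpha\beta}{(\alpha+\beta)(\alpha+\beta+1)(\xi(\alpha+\beta)-\beta+\alpha)}\Big).$$ Let $\mu_{1,n}$ be the smallest zero of $A_n$. Then $$\lim_{n\to\infty}\mu_{1,n}=0.$$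
   Context: The zeros of $A_n$ are real and positive. The number $\mu_{1,n}$ arises from the Markov-Bernstein inequality $c_1((p')^2)\le\frac1{\mu_{1,n}}c_0(p^2)$ for real polynomials $p$ of degree at most $n$, where $c_0$ is integration against $|x-\xi|(1-x)^{\alpha-1}(1+x)^{\beta-1}dx$ on $]-1,1[$ and $c_1$ is integration against $(1-x)^{\alpha}(1+x)^{\beta}dx$ on $]-1,1[$. *)

(* Defs.v *)
From HB Require Import structures.
From mathcomp Require Import all_boot all_order all_algebra.
From mathcomp Require Import all_classical all_reals all_analysis.

Set Implicit Arguments.
Unset Strict Implicit.
Unset Printing Implicit Defensive.

Import Order.TTheory GRing.Theory Num.Theory.

Local Open Scope ring_scope.

(* Only used under 1 < `|xi|, where the else branch means 1 < xi. *)
Definition epsilon (R : realType) (xi : R) : R := if xi < -1 then 1 else -1.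

(* In coefB and coefC the integer n is used for n >= 2 only; all subtractions
   are performed in R. *)
Definition coefB (R : realType) (alpha beta xi : R) (n : nat) : R :=
  epsilon xi / (n%:R * (n%:R + alpha + beta - 1)) *
  (xi - (beta - alpha) * (alpha + beta - 2) /
        ((2 * n%:R + alpha + beta - 2) * (2 * n%:R + alpha + beta))).

Definition coefC (R : realType) (alpha beta : R) (n : nat) : R :=
  4 * (n%:R + alpha - 1) * (n%:R + beta - 1) /
  ((n%:R - 1) * (n%:R + alpha + beta - 1) * (2 * n%:R + alpha + beta - 1) *
   (2 * n%:R + alpha + beta - 2) ^+ 2 * (2 * n%:R + alpha + beta - 3)).

Definition polyA1 (R : realType) (alpha beta xi : R) : {poly R} :=
  'X + (epsilon xi / (alpha + beta) *
        (xi - (beta - alpha) * (alpha + beta - 2) /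
              ((2 + alpha + beta) * (alpha + beta))
            - 4 * alpha * beta /
              ((alpha + beta) * (alpha + beta + 1) *
               (xi * (alpha + beta) - beta + alpha))))%:P.

Fixpoint polyA (R : realType) (alpha beta xi : R) (n : nat) : {poly R} :=
  match n with
  | 0 => 1
  | n1.+1 =>
    match n1 with
    | 0 => polyA1 alpha beta xi
    | n2.+1 => ('X + (coefB alpha beta xi n)%:P) * polyA alpha beta xi n1
               - coefC alpha beta n *: polyA alpha beta xi n2
    end
  end.

Definition is_smallest_zero (R : realType) (p : {poly R}) (x : R) : Prop :=
  root p x /\ forall y : R, root p y -> x <= y.

(* Main.v *)
(** The reflection [(alpha, beta, xi) -> (beta, alpha, - xi)] fixes [A_n], so let
    [1 < xi]. Then [(-1)^n A_n] is the characteristic polynomial of a Jacobi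
    matrix with diagonal [b_n = - B_n] and squared off-diagonal [C_n]. Up to
    positive factors, [(-1)^n A_n(0)] is the Jacobi polynomial
    P_{n+1}^(alpha-1,beta-1)(xi), and its consecutive ratios dominate the
    explicit ones at [xi = 1]; hence these matrices are positive definite and
    [mu_n > 0]. At a zero of [A_n] the recurrence forces the sign of [A_{n+1}],
    so [mu_n] decreases, and evaluating it at [b_n] gives [mu_n <= b_n],
    where [b_n = O(1/n)]. *)

Require Import Defs.
From HB Require Import structures.
From mathcomp Require Import all_boot all_order all_algebra.
From mathcomp Require Import all_classical all_reals all_analysis.
From mathcomp Require Import ring lra.

Set Implicit Arguments.
Unset Strict Implicit.
Unset Printing Implicit Defensive.

Import Order.TTheory GRing.Theory Num.Theory.
Import numFieldNormedType.Exports.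

Local Open Scope classical_set_scope.
Local Open Scope ring_scope.

(** * Smallest zeros under a general three-term recurrence *)

Definition three_term (R : realType) (b c : nat -> R) (A : nat -> {poly R}) :=
  [/\ A 0%N = 1, A 1%N = 'X - (b 1%N)%:P &
      forall n, A n.+2 = ('X - (b n.+2)%:P) * A n.+1 - c n.+2 *: A n].

Definition signed_value (R : realType) (A : nat -> {poly R}) (n : nat) (x : R) :=
  (-1) ^+ n * (A n).[x].

(* [tau n] bounds from below the ratio of consecutive signed values at 0; this
   is the chain-sequence criterion for positivity of a Jacobi matrix. *)
Definition ratio_minorant (R : realType) (b c tau : nat -> R) :=
  [/\ forall n, 0 < tau n.+1, tau 1%N <= b 1%N &
      forall n, tau n.+2 <= b n.+2 - c n.+2 / tau n.+1].

Lemma signed_value0 (R : realType) (b c : nat -> R) (A : nat -> {poly R}) x :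
  three_term b c A -> signed_value A 0 x = 1.
Proof. by case=> A0 _ _; rewrite /signed_value A0 hornerC expr0 mul1r. Qed.

Lemma signed_value1 (R : realType) (b c : nat -> R) (A : nat -> {poly R}) x :
  three_term b c A -> signed_value A 1 x = b 1%N - x.
Proof.
by case=> _ A1 _; rewrite /signed_value A1 expr1 hornerXsubC mulN1r opprB.
Qed.

Lemma signed_valueSS (R : realType) (b c : nat -> R) (A : nat -> {poly R}) n x :
  three_term b c A ->
  signed_value A n.+2 x =
    (b n.+2 - x) * signed_value A n.+1 x - c n.+2 * signed_value A n x.
Proof.
case=> _ _ AS; rewrite /signed_value AS hornerD hornerN hornerZ hornerM.
by rewrite hornerXsubC !exprS; ring.
Qed.

Lemma signed_value_eq0 (R : realType) (A : nat -> {poly R}) n x :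
  (signed_value A n x == 0) = root (A n) x.
Proof. by rewrite /signed_value mulf_eq0 signr_eq0. Qed.

(** Divided by its predecessor, the signed value has a ratio obeying [r' = b - x - c / r], which
    increases with [r]. So the bound [tau <= r] propagates by induction, and [x <= 0] only helps. *)
Lemma signed_value_gt0_nonpos (R : realType) (b c tau : nat -> R)
    (A : nat -> {poly R}) n x :
  three_term b c A -> (forall n, 0 < c n.+2) -> ratio_minorant b c tau ->
  x <= 0 -> 0 < signed_value A n x.
Proof.
move=> hA c_gt0 [tau_gt0 tau1 tauS] x_le0.
suff: 0 < signed_value A n x /\
      tau n.+1 * signed_value A n x <= signed_value A n.+1 x by case.
elim: n => [|n [IH0 IH1]].
  by rewrite (signed_value0 _ hA) (signed_value1 _ hA); split; lra.
have v_gt0 : 0 < signed_value A n.+1 x.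
  by apply: lt_le_trans IH1; rewrite mulr_gt0.
split=> //; rewrite (signed_valueSS _ _ hA).
have h1 : c n.+2 * signed_value A n x
          <= c n.+2 / tau n.+1 * signed_value A n.+1 x.
  by rewrite -mulrA ler_wpM2l ?(ltW (c_gt0 _))// ler_pdivlMl.
have h2 := ler_wpM2r (ltW v_gt0) (tauS n).
have h3 : 0 <= - x * signed_value A n.+1 x by rewrite mulr_ge0 ?oppr_ge0 ?(ltW v_gt0).
lra.
Qed.

Lemma signed_value_gt0_lt_zero (R : realType) (b c tau : nat -> R)
    (A : nat -> {poly R}) n m x :
  three_term b c A -> (forall n, 0 < c n.+2) -> ratio_minorant b c tau ->
  is_smallest_zero (A n) m -> x < m -> 0 < signed_value A n x.
Proof.
move=> hA c_gt0 htau [_ m_min] x_lt_m.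
have [x_le0|x_gt0] := leP x 0.
  exact: (signed_value_gt0_nonpos _ hA c_gt0 htau).
rewrite ltNge; apply/negP => vx_le0.
have v0_gt0 := signed_value_gt0_nonpos n hA c_gt0 htau (lexx 0).
(* A nonpositive value at [x] would force a zero in [[0, x]], to the left of [m]. The polynomial is
   negated because [poly_ivt] expects a rise from nonpositive to nonnegative. *)
have [|y /andP[_ y_le_x]] :=
  @poly_ivt R (- ((-1) ^+ n *: A n)) 0 x (ltW x_gt0).
  by rewrite !hornerE oppr_ge0 vx_le0 oppr_le0 ltW.
rewrite rootN rootZ ?signr_eq0// => /m_min.
by rewrite leNgt (le_lt_trans y_le_x).
Qed.

Lemma smallest_zero_gt0 (R : realType) (b c tau : nat -> R)
    (A : nat -> {poly R}) n m :
  three_term b c A -> (forall n, 0 < c n.+2) -> ratio_minorant b c tau ->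
  is_smallest_zero (A n) m -> 0 < m.
Proof.
move=> hA c_gt0 htau [m_root _]; rewrite ltNge; apply/negP => m_le0.
have := signed_value_gt0_nonpos n hA c_gt0 htau m_le0.
by rewrite lt_neqAle eq_sym signed_value_eq0 m_root.
Qed.

Lemma smallest_zero_decr (R : realType) (b c tau mu : nat -> R)
    (A : nat -> {poly R}) n :
  three_term b c A -> (forall n, 0 < c n.+2) -> ratio_minorant b c tau ->
  (forall n, (1 <= n)%N -> is_smallest_zero (A n) (mu n)) ->
  mu n.+2 < mu n.+1.
Proof.
move=> hA c_gt0 htau hmu.
have pos_below k x := @signed_value_gt0_lt_zero R b c tau A k.+1 (mu k.+1) x
  hA c_gt0 htau (hmu k.+1 isT).
(* At [mu k.+1] the recurrence leaves only the term in [- c k.+2], so the signed value of index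
   [k.+2] is negative there, whereas left of [mu k.+2] it is positive. *)
have step k : 0 < signed_value A k (mu k.+1) -> mu k.+2 < mu k.+1.
  move=> v_gt0; rewrite ltNge; apply/negP => mu_le.
  have v_lt0 : signed_value A k.+2 (mu k.+1) < 0.
    have /eqP e : signed_value A k.+1 (mu k.+1) == 0.
      by rewrite signed_value_eq0; case: (hmu k.+1 isT).
    by rewrite (signed_valueSS _ _ hA) e mulr0 sub0r oppr_lt0 mulr_gt0.
  move: mu_le; rewrite le_eqVlt => /predU1P[e|/pos_below]; last first.
    by rewrite ltNge (ltW v_lt0).
  move: v_lt0; rewrite e lt_neqAle signed_value_eq0.
  by case: (hmu k.+2 isT) => ->.
(* The previous descent puts [mu n.+2] left of [mu n.+1], where the signed value of index [n.+1] is
   positive. *)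
elim: n => [|n IH]; apply: step; last exact: pos_below.
by rewrite (signed_value0 _ hA).
Qed.

(** This is the Rayleigh bound of the least eigenvalue by a diagonal entry. At [x = b n.+2] the
    recurrence gives the signed values of indices [n.+2] and [n] opposite signs, but both would be
    positive if [x] were below [mu n.+2]. *)
Lemma smallest_zero_le_diag (R : realType) (b c tau mu : nat -> R)
    (A : nat -> {poly R}) n :
  three_term b c A -> (forall n, 0 < c n.+2) -> ratio_minorant b c tau ->
  (forall n, (1 <= n)%N -> is_smallest_zero (A n) (mu n)) ->
  mu n.+2 <= b n.+2.
Proof.
move=> hA c_gt0 htau hmu; rewrite leNgt; apply/negP => b_lt.
have pos_below k := @signed_value_gt0_lt_zero R b c tau A k.+1 (mu k.+1)
  (b n.+2) hA c_gt0 htau (hmu k.+1 isT).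
have decr k := smallest_zero_decr k hA c_gt0 htau hmu.
have := pos_below _ b_lt.
rewrite (signed_valueSS _ _ hA) subrr mul0r sub0r oppr_gt0 pmulr_rlt0//.
case: n => [|n] in b_lt pos_below *.
  by rewrite (signed_value0 _ hA) ltNge ler01.
rewrite ltNge ltW//; apply: pos_below.
by rewrite (lt_trans b_lt)// (lt_trans (decr _)).
Qed.

(** * The Jacobi coefficients and their reflection *)

Definition jacobi_diag (R : realType) (alpha beta xi : R) (n : nat) : R :=
  if n == 1%N then - (polyA1 alpha beta xi)`_0 else - Defs.coefB alpha beta xi n.

(* The ratio of the signed values at 0 in the limit case [xi = 1], read off the
   closed form 2^n (a+1)_n / (n+a+b+1)_n of the monic Jacobi polynomial
   P_n^(a,b)(1) with a = alpha - 1 and b = beta - 1. *)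
Definition jacobi_minorant (R : realType) (alpha beta : R) (n : nat) : R :=
  2 * (n%:R + alpha) /
  (n%:R * (2 * n%:R + alpha + beta) * (2 * n%:R + alpha + beta - 1)).

Lemma epsilonN1 (R : realType) (xi : R) : 1 < xi -> epsilon xi = -1.
Proof. by move=> xi_gt1; rewrite /epsilon lt_gtF//; lra. Qed.

Lemma epsilon1 (R : realType) (xi : R) : xi < -1 -> epsilon xi = 1.
Proof. by rewrite /epsilon => ->. Qed.

(** Both [epsilon] and the bracket change sign. From index 2 on, all denominators are positive. *)
Lemma coefBN (R : realType) (alpha beta xi : R) n :
  0 < alpha -> 0 < beta -> xi < -1 ->
  Defs.coefB beta alpha (- xi) n.+2 = Defs.coefB alpha beta xi n.+2.
Proof.
move=> a_gt0 b_gt0 xi_lt; have n_ge0 : 0 <= n%:R :> R by [].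
have Nxi_gt1 : 1 < - xi by rewrite ltrNr.
rewrite /Defs.coefB (epsilon1 xi_lt) epsilonN1//.
rewrite -(addn2 n) natrD; move: (n%:R : R) n_ge0 => t t_ge0.
by field; do ?[apply/andP; split]; apply: lt0r_neq0; lra.
Qed.

Lemma coefC_symm (R : realType) (alpha beta : R) n :
  0 < alpha -> 0 < beta -> Defs.coefC beta alpha n.+2 = Defs.coefC alpha beta n.+2.
Proof.
move=> a_gt0 b_gt0; have n_ge0 : 0 <= n%:R :> R by [].
rewrite /Defs.coefC -(addn2 n) natrD; move: (n%:R : R) n_ge0 => t t_ge0.
by field; do ?[apply/andP; split]; apply: lt0r_neq0; lra.
Qed.

Lemma polyA1N (R : realType) (alpha beta xi : R) :
  0 < alpha -> 0 < beta -> xi < -1 ->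
  polyA1 beta alpha (- xi) = polyA1 alpha beta xi.
Proof.
move=> a_gt0 b_gt0 xi_lt; have Nxi_gt1 : 1 < - xi by rewrite ltrNr.
rewrite /polyA1 (epsilon1 xi_lt) epsilonN1//.
congr (_ + _%:P).
(* The one denominator factor involving [xi]: positive after reflection, hence negative before
   it. *)
have d_gt0 : 0 < - xi * (alpha + beta) + beta - alpha by nra.
field; do ?[apply/andP; split]; try (apply: lt0r_neq0; lra).
by apply: ltr0_neq0; lra.
Qed.

Lemma polyASS (R : realType) (alpha beta xi : R) n :
  polyA alpha beta xi n.+2 =
    ('X + (Defs.coefB alpha beta xi n.+2)%:P) * polyA alpha beta xi n.+1
    - Defs.coefC alpha beta n.+2 *: polyA alpha beta xi n.
Proof. by []. Qed.

Lemma polyAN (R : realType) (alpha beta xi : R) n :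
  0 < alpha -> 0 < beta -> xi < -1 ->
  polyA beta alpha (- xi) n = polyA alpha beta xi n.
Proof.
move=> a_gt0 b_gt0 xi_lt.
suff: polyA beta alpha (- xi) n = polyA alpha beta xi n /\
      polyA beta alpha (- xi) n.+1 = polyA alpha beta xi n.+1 by case.
elim: n => [|n [IH0 IH1]]; first by split=> //=; exact: polyA1N.
split=> //; rewrite /= in IH1 *.
by rewrite coefBN// coefC_symm// IH1 IH0.
Qed.

Lemma polyA1_coef0 (R : realType) (alpha beta xi : R) :
  polyA1 alpha beta xi = 'X + ((polyA1 alpha beta xi)`_0)%:P.
Proof. by rewrite /polyA1 coefD coefX coefC eqxx add0r. Qed.

Lemma polyA_three_term (R : realType) (alpha beta xi : R) :
  three_term (jacobi_diag alpha beta xi) (Defs.coefC alpha beta)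
             (polyA alpha beta xi).
Proof.
split=> [//||n]; rewrite /jacobi_diag polyCN opprK//.
exact: polyA1_coef0.
Qed.

(** * Positivity of the coefficients and the ratio minorant *)

Lemma coefC_gt0 (R : realType) (alpha beta : R) n :
  0 < alpha -> 0 < beta -> 0 < Defs.coefC alpha beta n.+2.
Proof.
move=> a_gt0 b_gt0; have n_ge0 : 0 <= n%:R :> R by [].
rewrite /Defs.coefC -(addn2 n) natrD; move: (n%:R : R) n_ge0 => t t_ge0.
by apply: divr_gt0; repeat (apply: mulr_gt0 || apply: exprn_gt0); lra.
Qed.

Lemma jacobi_minorant_gt0 (R : realType) (alpha beta : R) n :
  0 < alpha -> 0 < beta -> 0 < jacobi_minorant alpha beta n.+1.
Proof.
move=> a_gt0 b_gt0; have n_ge0 : 0 <= n%:R :> R by [].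
rewrite /jacobi_minorant -(addn1 n) natrD; move: (n%:R : R) n_ge0 => t t_ge0.
by apply: divr_gt0; repeat apply: mulr_gt0; lra.
Qed.

Lemma jacobi_minorant1 (R : realType) (alpha beta xi : R) :
  0 < alpha -> 0 < beta -> 1 < xi ->
  jacobi_minorant alpha beta 1 <= jacobi_diag alpha beta xi 1.
Proof.
move=> a_gt0 b_gt0 xi_gt1.
rewrite /jacobi_diag eqxx /polyA1 coefD coefX coefC eqxx add0r /= epsilonN1//.
rewrite /jacobi_minorant !mulr1 mul1r.
have d_gt0 : 0 < xi * (alpha + beta) - beta + alpha by nra.
rewrite -subr_ge0.
(* At [xi = 1] the two sides agree, hence the factor [xi - 1]. *)
have -> : - (-1 / (alpha + beta) *
   (xi - (beta - alpha) * (alpha + beta - 2) /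
      ((2 + alpha + beta) * (alpha + beta)) -
    4 * alpha * beta / ((alpha + beta) * (alpha + beta + 1) *
      (xi * (alpha + beta) - beta + alpha)))) -
  2 * (1 + alpha) / ((2 + alpha + beta) * (2 + alpha + beta - 1)) =
  (xi - 1) / (alpha + beta) * (1 + 2 * beta /
      ((alpha + beta + 1) * (xi * (alpha + beta) - beta + alpha))).
  field; do ?[apply/andP; split]; apply: lt0r_neq0; lra.
apply: mulr_ge0; first by apply: divr_ge0; lra.
by apply: addr_ge0 => //; apply: divr_ge0; [|apply: mulr_ge0]; lra.
Qed.

(** Equality holds at [xi = 1], and only the diagonal entry depends on [xi], affinely; the
    difference is its slope times [xi - 1]. *)
Lemma jacobi_minorantSS (R : realType) (alpha beta xi : R) n :
  0 < alpha -> 0 < beta -> 1 < xi ->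
  jacobi_minorant alpha beta n.+2 <=
    jacobi_diag alpha beta xi n.+2 -
    Defs.coefC alpha beta n.+2 / jacobi_minorant alpha beta n.+1.
Proof.
move=> a_gt0 b_gt0 xi_gt1; have n_ge0 : 0 <= n%:R :> R by [].
rewrite /jacobi_minorant /jacobi_diag /= /Defs.coefB /Defs.coefC epsilonN1//.
rewrite -(addn2 n) -(addn1 n) !natrD.
move: (n%:R : R) n_ge0 => t t_ge0; rewrite -subr_ge0.
set lhs := (X in 0 <= X).
have -> : lhs = (xi - 1) / ((t + 2) * (t + 2 + alpha + beta - 1)).
  by rewrite /lhs; field; do ?[apply/andP; split]; apply: lt0r_neq0; lra.
by apply: divr_ge0; [|apply: mulr_ge0]; lra.
Qed.

Lemma jacobi_ratio_minorant (R : realType) (alpha beta xi : R) :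
  0 < alpha -> 0 < beta -> 1 < xi ->
  ratio_minorant (jacobi_diag alpha beta xi) (Defs.coefC alpha beta)
                 (jacobi_minorant alpha beta).
Proof.
move=> a_gt0 b_gt0 xi_gt1; split=> [n||n].
- exact: jacobi_minorant_gt0.
- exact: jacobi_minorant1.
- exact: jacobi_minorantSS.
Qed.

(** * Decay of the diagonal and the limit *)

Lemma jacobi_diag_le (R : realType) (alpha beta xi : R) n :
  0 < alpha -> 0 < beta -> 1 < xi ->
  jacobi_diag alpha beta xi n.+2 <=
    (xi + `|(beta - alpha) * (alpha + beta - 2)|) * n.+1%:R^-1.
Proof.
move=> a_gt0 b_gt0 xi_gt1; have n_ge0 : 0 <= n%:R :> R by [].
rewrite /jacobi_diag /= /Defs.coefB epsilonN1// -(addn2 n) -(addn1 n) !natrD.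
move: (n%:R : R) n_ge0 => t t_ge0.
set k := (beta - alpha) * _.
rewrite mulN1r mulNr opprK mulrC.
set D := (_ * (2 * _ + _ + _)).
have D_ge1 : 1 <= D by rewrite /D; nra.
have q_le : `|k / D| <= `|k|.
  rewrite normrM normfV ler_piMr// invf_le1; first exact: le_trans (ler_norm D).
  by rewrite normr_gt0; apply: lt0r_neq0; lra.
apply: (@le_trans _ _
  ((xi + `|k|) / ((t + 2) * (t + 2 + alpha + beta - 1)))).
  apply: ler_wpM2r; first by rewrite invr_ge0; nra.
  by move: (lerNnormlW q_le); lra.
apply: ler_wpM2l; first by rewrite addr_ge0//; lra.
(* The quadratic denominator is weakened to [t + 1], to match [harmonic]. *)
by rewrite lef_pV2 ?posrE; nra.
Qed.

Theorem mainTheorem16 (R : realType) (alpha beta xi : R) (mu : nat -> R)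
    (halpha : 0 < alpha) (hbeta : 0 < beta) (hxi : 1 < `|xi|)
    (hmu : forall n : nat, (1 <= n)%N ->
       is_smallest_zero (polyA alpha beta xi n) (mu n)) :
  mu n @[n --> \oo] --> (0 : R).
Proof.
wlog xi_gt1 : alpha beta xi halpha hbeta hxi hmu / 1 < xi.
  move=> main; have [xi_gt1|xi_le1] := ltP 1 xi; first exact: (main alpha beta xi).
  have xi_lt : xi < -1 by move: hxi; rewrite lter_normr => /orP[]; lra.
  apply: (main beta alpha (- xi)) => //; rewrite ?normrN//; last lra.
  by move=> n n_ge1; rewrite polyAN//; exact: hmu.
have hA := polyA_three_term alpha beta xi.
have c_gt0 n := coefC_gt0 n halpha hbeta.
have htau := jacobi_ratio_minorant halpha hbeta xi_gt1.
(* Two shifts, since [mu 0] is unconstrained and the diagonal bounds start at index 2. *)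
rewrite -cvg_shiftS -cvg_shiftS /=.
pose K := xi + `|(beta - alpha) * (alpha + beta - 2)|.
apply: (@squeeze_cvgr _ _ _ _ (fun=> 0) (fun n => K * harmonic n)).
- apply: nearW => n; rewrite (ltW (smallest_zero_gt0 hA c_gt0 htau (hmu n.+2 isT))).
  apply: le_trans (jacobi_diag_le n halpha hbeta xi_gt1).
  exact: (smallest_zero_le_diag _ hA c_gt0 htau hmu).
- exact: cvg_cst.
- by rewrite -(mulr0 K); apply: cvgMl_tmp; exact: cvg_harmonic.
Qed.
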